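(* Let $\mathcal{X}$ be a finite set, let $f$ be a non-negative non-decreasing set submodular function on the subsets of $\mathcal{X}$ with $f(\emptyset)=0$, let $k$ be an integer with $0<k<|\mathcal{X}|$, and let $\mathcal{S}_k^*$ be a set that maximizes $f(\mathcal{S})$ over all subsets $\mathcal{S}\subset\mathcal{X}$ with $|\mathcal{S}|=k$. (1) If $\mathcal{S}_k$ is the output of the 1-interchange algorithm with additive relaxation factor $\theta_a\ge 0$, then $$0\le f(\mathcal{S}_k^* )-f(\mathcal{S}_k)\le \frac{k-1}{2k-1}\,f(\mathcal{S}_k^* )+\frac{k^2}{2k-1}\,\theta_a,$$ where $\frac{k-1}{2k-1}<\frac12$ and $\frac{k^2}{2k-1}\le k$. (2) If $\mathcal{S}_k$ is the output of the 1-interchange algorithm with multiplicative relaxation factor $\theta_m\ge 1$, then $$0\le f(\mathcal{S}_k^* )-f(\mathcal{S}_k)\le \frac{k-1+k^2(\theta_m-1)}{2k-1+k^2(\theta_m-1)}\,f(\mathcal{S}_k^* ).$$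
   Context: Given a finite set $\mathcal{X}$, a real-valued function $f$ on the subsets of $\mathcal{X}$ is a set submodular function if $f(\mathcal{T}\cup\{x\})-f(\mathcal{T})\le f(\mathcal{S}\cup\{x\})-f(\mathcal{S})$ for all $\mathcal{S}\subset\mathcal{T}\subset\mathcal{X}$ and $x\in\mathcal{X}-\mathcal{T}$. It is non-decreasing if $f(\mathcal{T}\cup\{x\})-f(\mathcal{T})\ge 0$ for all $\mathcal{T}\subset\mathcal{X}$ and $x\in\mathcal{X}-\mathcal{T}$. Here $\subset$ allows equality. 1-interchange algorithm: start with any subset $\mathcal{S}^{(0)}\subset\mathcal{X}$ with $|\mathcal{S}^{(0)}|=k$ and $i=0$. While there exist $x\in\mathcal{S}^{(i)}$ and $y\in\mathcal{X}-\mathcal{S}^{(i)}$ satisfying the improvement condition below, pick such a pair, set $\mathcal{S}^{(i+1)}=(\mathcal{S}^{(i)}-\{x\})\cup\{y\}$ and increase $i$ by one. When no such pair exists, output the current set $\mathcal{S}_k$. The improvement condition is: - additive relaxation factor $\theta_a\ge 0$: $f((\mathcal{S}^{(i)}-\{x\})\cup\{y\})>f(\mathcal{S}^{(i)})+\theta_a$; - multiplicative relaxation factor $\theta_m\ge 1$: $f((\mathcal{S}^{(i)}-\{x\})\cup\{y\})>\theta_m f(\mathcal{S}^{(i)})$. Thus the output is locally optimal: for all $x\in\mathcal{S}_k$, $y\in\mathcal{X}-\mathcal{S}_k$, one has $f((\mathcal{S}_k-\{x\})\cup\{y\})\le f(\mathcal{S}_k)+\theta_a$, respectively $\le\theta_m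 f(\mathcal{S}_k)$. *)

(* Defs.v *)
From mathcomp Require Import all_boot all_order all_algebra.

Set Implicit Arguments.
Unset Strict Implicit.
Unset Printing Implicit Defensive.

Import Order.TTheory GRing.Theory Num.Theory.
Local Open Scope ring_scope.

(* The ground set is the whole finite type X; all values are taken in an
   arbitrary real field R, of which the real numbers are an instance. *)

Definition submodular (R : realFieldType) (X : finType) (f : {set X} -> R) :
    Prop :=
  forall (S T : {set X}) (x : X), S \subset T -> x \notin T ->
    f (T :|: [set x]) - f T <= f (S :|: [set x]) - f S.

Definition nondecreasing_setfun (R : realFieldType) (X : finType)
    (f : {set X} -> R) : Prop :=
  forall (T : {set X}) (x : X), x \notin T -> 0 <= f (T :|: [set x]) - f T.

Definition maximizer_of_size (R : realFieldType) (X : finType)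
    (f : {set X} -> R) (k : nat) (S : {set X}) : Prop :=
  #|S| = k /\ forall S' : {set X}, #|S'| = k -> f S' <= f S.

Definition interchange (X : finType) (S : {set X}) (x y : X) : {set X} :=
  (S :\ x) :|: [set y].

(* In [improves S S'], S is the current set and S' the candidate set. *)
Definition additive_improvement (R : realFieldType) (X : finType)
    (f : {set X} -> R) (theta : R) (S S' : {set X}) : Prop :=
  f S' > f S + theta.

Definition multiplicative_improvement (R : realFieldType) (X : finType)
    (f : {set X} -> R) (theta : R) (S S' : {set X}) : Prop :=
  f S' > theta * f S.

(* The sets that can occur as some S^(i): the initial set and the improving
   pair chosen at each step are both arbitrary. *)
Inductive interchange_iterate (X : finType)
    (improves : {set X} -> {set X} -> Prop) (k : nat) : {set X} -> Prop :=
| iterate_start (S : {set X}) :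
    #|S| = k -> interchange_iterate improves k S
| iterate_step (S : {set X}) (x y : X) :
    interchange_iterate improves k S ->
    x \in S -> y \notin S -> improves S (interchange S x y) ->
    interchange_iterate improves k (interchange S x y).

Definition interchange_output (X : finType)
    (improves : {set X} -> {set X} -> Prop) (k : nat) (S : {set X}) : Prop :=
  interchange_iterate improves k S /\
  ~ exists x y : X,
      [/\ x \in S, y \notin S & improves S (interchange S x y)].

(* Main.v *)
Require Import Defs.
From mathcomp Require Import all_boot all_order all_algebra.
From mathcomp Require Import lra.

(** Let S be the output, O a maximizer, and delta a bound on the gain of any
    single interchange from S; delta is [theta_a] in the additive case and
    (theta_m - 1) f(S) in the multiplicative one.  Both bounds follow from

      k f(O) <= (2k - 1) f(S) + k^2 delta        ([local_optimum_bound]).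

    To see this, fix x in S and let rho_x = f(S) - f(S - x) be the loss from
    removing it.  Adding any z to S - x reaches value at most f(S) + delta:
    this is local optimality if z is outside S, and monotonicity otherwise.  So
    the marginal value of z at S - x is at most rho_x + delta.  By submodularity
    inserting the k elements of O into S - x then gives, for every x in S,

      f(O) <= f((S - x) + O) <= f(S - x) + k (rho_x + delta).

    Since f(S - x) = f(S) - rho_x, the right-hand side contains rho_x only
    k - 1 times; starting from S instead of S - x would leave k copies of it,
    and 2k instead of 2k - 1 in the end.  Now sum over x in S: submodularity
    makes the losses rho_x add up to at most f(S) - f(set0) = f(S), since when S
    is emptied one element at a time each x costs at least rho_x
    ([sum_removal_loss_le]). *)

Set Implicit Arguments.
Unset Strict Implicit.
Unset Printing Implicit Defensive.

Import Order.TTheory GRing.Theory Num.Theory.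
Local Open Scope ring_scope.

Lemma set_ind (X : finType) (P : {set X} -> Prop) :
    P set0 ->
    (forall (A : {set X}) (x : X), x \notin A -> P A -> P (x |: A)) ->
  forall A, P A.
Proof.
move=> P0 PU A; have [n] := ubnP #|A|.
elim: n A => // n IHn A; rewrite ltnS => leAn.
have [-> //|[x xA]] := set_0Vmem A.
rewrite -(setD1K xA); apply: PU; first by rewrite setD11.
by apply: IHn; move: leAn; rewrite (cardsD1 x A) xA.
Qed.

Lemma nondecreasing_subset (R : realFieldType) (X : finType)
    (f : {set X} -> R) (A B : {set X}) :
  nondecreasing_setfun f -> A \subset B -> f A <= f B.
Proof.
move=> f_nd sAB; rewrite -(setUidPr sAB); elim/set_ind: B {sAB} => [|B x _ IH].
  by rewrite setU0.
rewrite [x |: B]setUC setUA; have [xAB|xNAB] := boolP (x \in A :|: B).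
  by rewrite [_ :|: [set x]](setUidPl _) // sub1set.
by have := f_nd _ _ xNAB; lra.
Qed.

(** For monotone functions diminishing returns persist when x already lies in
    T, because then the left-hand side vanishes while the
    right-hand side is non-negative. *)
Lemma marginal_antitone (R : realFieldType) (X : finType)
    (f : {set X} -> R) (S T : {set X}) (x : X) :
  nondecreasing_setfun f -> submodular f -> S \subset T ->
  f (T :|: [set x]) - f T <= f (S :|: [set x]) - f S.
Proof.
move=> f_nd f_sub sST; have [xT|] := boolP (x \in T); last exact: f_sub.
rewrite [T :|: _](setUidPl _) ?sub1set // subrr subr_ge0.
by apply: nondecreasing_subset => //; exact: subsetUl.
Qed.

(** Inserting the elements of B into A one at a time, each step gains at most
    what it would have gained at A. *)
Lemma union_le_sum_marginals (R : realFieldType) (X : finType)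
    (f : {set X} -> R) (A B : {set X}) :
  nondecreasing_setfun f -> submodular f ->
  f (A :|: B) <= f A + \sum_(b in B) (f (A :|: [set b]) - f A).
Proof.
move=> f_nd f_sub; elim/set_ind: B => [|B x xNB IH].
  by rewrite setU0 big_set0 addr0.
rewrite big_setU1 //= [x |: B]setUC setUA.
have := marginal_antitone x f_nd f_sub (subsetUl A B).
lra.
Qed.

(** The loss from removing x only grows as other elements are taken out of S
    first, so these losses sum to at most the loss from emptying S. *)
Lemma sum_removal_loss_le (R : realFieldType) (X : finType)
    (f : {set X} -> R) (S : {set X}) :
  submodular f -> \sum_(x in S) (f S - f (S :\ x)) <= f S - f set0.
Proof.
move=> f_sub; elim/set_ind: S => [|S z zNS IH].
  by rewrite big_set0 subrr.
rewrite big_setU1 //= setU1K //.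
suff: \sum_(x in S) (f (z |: S) - f ((z |: S) :\ x))
        <= \sum_(x in S) (f S - f (S :\ x)) by lra.
apply: ler_sum => x xS.
have := f_sub _ _ x (setSD [set x] (subsetUr [set z] S)).
by rewrite setD11 ![_ :\ x :|: _]setUC !setD1K ?inE ?xS ?orbT //; apply.
Qed.

(** The intermediate set is (S - x) + O rather than S + O, so that the chain
    starts at the smaller value f(S - x). *)
Lemma local_optimum_bound_at (R : realFieldType) (X : finType)
    (f : {set X} -> R) (S O : {set X}) (delta : R) (x : X) :
    nondecreasing_setfun f -> submodular f -> 0 <= delta -> x \in S ->
    (forall y, y \notin S -> f (Defs.interchange S x y) <= f S + delta) ->
  f O <= f (S :\ x) + #|O|%:R * (f S - f (S :\ x) + delta).
Proof.
move=> f_nd f_sub delta_ge0 xS locopt.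
(* For z in S this is monotonicity, so O is allowed to meet S. *)
have insert_le z : f (S :\ x :|: [set z]) <= f S + delta.
  have [zS|/locopt //] := boolP (z \in S).
  apply: (@le_trans _ _ (f S)); last by rewrite lerDl.
  apply: nondecreasing_subset => //.
  by rewrite subUset subD1set sub1set.
apply: (le_trans (nondecreasing_subset f_nd (subsetUr (S :\ x) O))).
apply: (le_trans (union_le_sum_marginals _ _ f_nd f_sub)).
rewrite lerD2l mulr_natl -sumr_const.
by apply: ler_sum => z _; have := insert_le z; lra.
Qed.

Lemma local_optimum_bound (R : realFieldType) (X : finType)
    (f : {set X} -> R) (k : nat) (S O : {set X}) (delta : R) :
    nondecreasing_setfun f -> submodular f -> f set0 = 0 ->
    0 <= delta -> (0 < k)%N -> #|S| = k -> #|O| = k ->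
    (forall x y, x \in S -> y \notin S ->
       f (Defs.interchange S x y) <= f S + delta) ->
  k%:R * f O <= (2 * k%:R - 1) * f S + k%:R ^+ 2 * delta.
Proof.
move=> f_nd f_sub f0 delta_ge0 k_gt0 cardS cardO locopt.
have k_ge1 : 1 <= k%:R :> R by rewrite ler1n.
pose rho x := f S - f (S :\ x).
have : \sum_(x in S) f O <=
    \sum_(x in S) (f S + k%:R * delta + (k%:R - 1) * rho x).
  apply: ler_sum => x xS.
  have := local_optimum_bound_at O f_nd f_sub delta_ge0 xS (locopt x ^~ xS).
  by rewrite cardO /rho; lra.
rewrite big_split /= -mulr_sumr !sumr_const cardS.
rewrite -(mulr_natl (f O)) -(mulr_natl (f S + _)).
have := sum_removal_loss_le S f_sub; rewrite f0 subr0.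
move=> rho_le.
have : (k%:R - 1) * \sum_(x in S) rho x <= (k%:R - 1) * f S.
  by rewrite ler_wpM2l // subr_ge0.
lra.
Qed.

Lemma card_interchange (X : finType) (S : {set X}) (x y : X) :
  x \in S -> y \notin S -> #|Defs.interchange S x y| = #|S|.
Proof.
move=> xS yNS; rewrite /Defs.interchange setUC cardsU1 (cardsD1 x S) xS.
by rewrite !inE (negPf yNS) andbF.
Qed.

Lemma card_interchange_iterate (X : finType)
    (improves : {set X} -> {set X} -> Prop) (k : nat) (S : {set X}) :
  interchange_iterate improves k S -> #|S| = k.
Proof. by elim=> // {}S x y _ <- xS yNS _; exact: card_interchange. Qed.

Theorem theorem2p4 (R : realFieldType) (X : finType) (f : {set X} -> R)
    (k : nat) (Sopt : {set X})
    (f_ge0 : forall S : {set X}, 0 <= f S)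
    (f_nondecreasing : nondecreasing_setfun f)
    (f_submodular : submodular f)
    (f_set0 : f set0 = 0)
    (k_gt0 : (0 < k)%N) (k_lt : (k < #|X|)%N)
    (Sopt_max : maximizer_of_size f k Sopt) :
  ((forall (theta_a : R) (Sk : {set X}),
      0 <= theta_a ->
      interchange_output (additive_improvement f theta_a) k Sk ->
      0 <= f Sopt - f Sk /\
      f Sopt - f Sk <=
        (k%:R - 1) / (2 * k%:R - 1) * f Sopt
        + k%:R ^+ 2 / (2 * k%:R - 1) * theta_a) /\
   (k%:R - 1) / (2 * k%:R - 1) < 1 / 2 :> R /\
   k%:R ^+ 2 / (2 * k%:R - 1) <= k%:R :> R) /\
  (forall (theta_m : R) (Sk : {set X}),
      1 <= theta_m ->
      interchange_output (multiplicative_improvement f theta_m) k Sk ->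
      0 <= f Sopt - f Sk /\
      f Sopt - f Sk <=
        (k%:R - 1 + k%:R ^+ 2 * (theta_m - 1))
        / (2 * k%:R - 1 + k%:R ^+ 2 * (theta_m - 1)) * f Sopt).
Proof.
have [cardO O_max] := Sopt_max.
have k_ge1 : 1 <= k%:R :> R by rewrite ler1n.
have den_gt0 : 0 < 2 * k%:R - 1 :> R by lra.
split; first split; last 1 first.
- move=> theta Sk theta_ge1 [/card_interchange_iterate cardS locopt].
  have fS_le := O_max _ cardS.
  split; first by rewrite subr_ge0.
  have excess_ge0 : 0 <= k%:R ^+ 2 * (theta - 1).
    by rewrite mulr_ge0 ?exprn_ge0 ?subr_ge0 // ler0n.
  have slack_ge0 : 0 <= (theta - 1) * f Sk by rewrite mulr_ge0 ?subr_ge0.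
  have bound : k%:R * f Sopt
      <= (2 * k%:R - 1) * f Sk + k%:R ^+ 2 * ((theta - 1) * f Sk).
    apply: local_optimum_bound => // x y xS yNS.
    rewrite leNgt; apply/negP => lt_f; apply: locopt; exists x, y; split=> //.
    by rewrite /multiplicative_improvement; lra.
  rewrite mulrAC ler_pdivlMr; first by lra.
  by lra.
- move=> theta Sk theta_ge0 [/card_interchange_iterate cardS locopt].
  have fS_le := O_max _ cardS.
  split; first by rewrite subr_ge0.
  have bound : k%:R * f Sopt <= (2 * k%:R - 1) * f Sk + k%:R ^+ 2 * theta.
    apply: local_optimum_bound => // x y xS yNS.
    rewrite leNgt; apply/negP => lt_f; apply: locopt; exists x, y; split=> //.
  rewrite [_ / _ * f _]mulrAC [_ / _ * theta]mulrAC -mulrDl ler_pdivlMr //.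
  lra.
- split; first by rewrite ltr_pdivrMr //; lra.
  rewrite ler_pdivrMr //.
  have : 0 <= k%:R * (k%:R - 1) :> R by rewrite mulr_ge0 ?subr_ge0 ?ler0n.
  lra.
Qed.
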